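(* Let $\Sigma$ be a finite alphabet, let $L\subseteq\Sigma^{*}$ be a regular ideal language, let $S$ be the syntactic semigroup of $L$, and let $S(\mathscr{B})$ be the transition semigroup of a synchronizing deterministic finite automaton $\mathscr{B}$ over $\Sigma$ with $\mathrm{Syn}(\mathscr{B})=L$. Then $S$ is a homomorphic image of $S(\mathscr{B})$, i.e. there is a surjective semigroup homomorphism $S(\mathscr{B})\to S$.
   Context: A deterministic finite automaton (DFA) here is a triple $\mathscr{B}=\langle Q,\Sigma,\delta\rangle$ with finite nonempty state set $Q$, finite input alphabet $\Sigma$ and a total transition function $\delta:Q\times\Sigma\to Q$, extended to $Q\times\Sigma^{*}\to Q$ in the natural way. It is synchronizing if there is a word $w\in\Sigma^{*}$ with $\delta(q,w)=\delta(q',w)$ for all $q,q'\in Q$; such a $w$ is called a synchronizing word, and $\mathrm{Syn}(\mathscr{B})$ denotes the set of all synchronizing words of $\mathscr{B}$. The transition semigroup $S(\mathscr{B})$ is the semigroup of all transformations $q\mapsto\delta(q,u)$ of $Q$ induced by nonempty words $u\in\Sigma^{+}$, with transformations acting on the right, so that the product of the transformations induced by $u$ and $v$ (first $u$, then $v$) is the one induced by $uv$. A language $L\subseteq\Sigma^{*}$ is ideal if $L=\Sigma^{*}L\Sigma^{*}$. The syntactic (Myhill) congruence $\approx_L$ is defined by: $u\approx_L v$ if and only if for all $x,y\in\Sigma^{*}$ one has $xuy\in L\Leftrightarrow xvy\in L$. The syntactic semigroup of $L$ is the quotient $\Sigma^{+}/{\approx_L}$, where $\Sigma^{+}$ is the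 semigroup of nonempty words over $\Sigma$. *)

(* Defs.v *)
From HB Require Import structures.
From mathcomp Require Import all_boot.
From mathcomp Require Import boolp classical_sets.

Set Implicit Arguments.
Unset Strict Implicit.
Unset Printing Implicit Defensive.

Local Open Scope classical_set_scope.
Local Open Scope quotient_scope.

Notation language Sigma := (set (seq Sigma)).

Definition lang_cat (Sigma : Type) (K L : language Sigma) : language Sigma :=
  [set u ++ v | u in K & v in L].

Definition ideal_language (Sigma : Type) (L : language Sigma) : Prop :=
  L = lang_cat (lang_cat setT L) setT.

(* No initial or final states are part of the structure. *)
Record dfa (Sigma : finType) := DFA {
  state :> finType;
  trans : state -> Sigma -> state;
  state_nonempty : 0 < #|state|
}.

Definition run (Sigma : finType) (B : dfa Sigma) (q : B) (w : seq Sigma) : B :=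
  foldl (@trans Sigma B) q w.

Definition Syn (Sigma : finType) (B : dfa Sigma) : language Sigma :=
  [set w | forall q q' : B, run q w = run q' w].

Definition synchronizing (Sigma : finType) (B : dfa Sigma) : Prop :=
  exists w, Syn B w.

Definition regular (Sigma : finType) (L : language Sigma) : Prop :=
  exists (A : dfa Sigma) (q0 : A) (F : {set A}), L = [set w | run q0 w \in F].

Section NonemptyWords.
Variable Sigma : finType.

Definition nonempty_word : Type := {w : seq Sigma | w != [::]}.

HB.instance Definition _ := SubChoice.on nonempty_word.

Implicit Types u v : nonempty_word.

Fact cat_nonempty u v : val u ++ val v != [::].
Proof. by case: u => -[]. Qed.

Definition word_mul u v : nonempty_word := Sub (val u ++ val v) (cat_nonempty u v).

Fact word_mulA : associative word_mul.
Proof. by move=> u v w; apply: val_inj; rewrite /= catA. Qed.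

HB.instance Definition _ := isSemigroup.Build nonempty_word word_mulA.

Lemma val_word_mul u v : val (u * v)%g = val u ++ val v.
Proof. by []. Qed.

End NonemptyWords.

Section TransitionSemigroup.
Variables (Sigma : finType) (B : dfa Sigma).

Definition word_action (w : seq Sigma) : {ffun B -> B} := [ffun q => run q w].

Definition transition_semigroup : Type :=
  {t : {ffun B -> B} | `[< exists u : nonempty_word Sigma, t = word_action (val u) >]}.

HB.instance Definition _ := SubFinite.on transition_semigroup.

Implicit Types s t : transition_semigroup.

Lemma word_action_cat u v :
  word_action (u ++ v) = [ffun q => word_action v (word_action u q)].
Proof. by apply/ffunP => q; rewrite !ffunE /run foldl_cat. Qed.

Fact transition_mul_subproof s t :
  `[< exists u : nonempty_word Sigma,
        [ffun q => val t (val s q)] = word_action (val u) >].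
Proof.
apply/asboolP; case: s => s /= /asboolP[u ->]; case: t => t /= /asboolP[v ->].
by exists (u * v)%g; rewrite val_word_mul word_action_cat.
Qed.

(* Transformations act on the right: s * t is s followed by t. *)
Definition transition_mul s t : transition_semigroup :=
  Sub [ffun q => val t (val s q)] (transition_mul_subproof s t).

Fact transition_mulA : associative transition_mul.
Proof.
by move=> s t r; apply: val_inj; apply/ffunP => q; rewrite /= !ffunE.
Qed.

HB.instance Definition _ :=
  isSemigroup.Build transition_semigroup transition_mulA.

End TransitionSemigroup.

Definition syntactic_congruence (Sigma : Type) (L : language Sigma)
    (u v : seq Sigma) : Prop :=
  forall x y : seq Sigma, L (x ++ u ++ y) <-> L (x ++ v ++ y).

Section SyntacticSemigroup.
Variables (Sigma : finType) (L : language Sigma).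

Definition syntactic_rel : rel (nonempty_word Sigma) :=
  fun u v => `[< syntactic_congruence L (val u) (val v) >].

Fact syntactic_rel_refl : reflexive syntactic_rel.
Proof. by move=> u; apply/asboolP. Qed.

Fact syntactic_rel_sym : symmetric syntactic_rel.
Proof. by move=> u v; apply: asbool_equiv_eq; split=> h x y; split=> /h. Qed.

Fact syntactic_rel_trans : transitive syntactic_rel.
Proof.
move=> v u w /asboolP uv /asboolP vw; apply/asboolP => x y.
by rewrite (uv x y).
Qed.

Canonical syntactic_equiv :=
  EquivRel syntactic_rel syntactic_rel_refl syntactic_rel_sym syntactic_rel_trans.

Definition syntactic_semigroup : Type := {eq_quot syntactic_equiv}.

HB.instance Definition _ := EqQuotient.on syntactic_semigroup.
HB.instance Definition _ := Choice.on syntactic_semigroup.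

Lemma syntactic_piP (u v : nonempty_word Sigma) :
  \pi_syntactic_semigroup u = \pi_syntactic_semigroup v <->
  syntactic_congruence L (val u) (val v).
Proof. by split=> [/eqmodP/asboolP //|h]; apply/eqmodP/asboolP. Qed.

Definition syntactic_mul (a b : syntactic_semigroup) : syntactic_semigroup :=
  \pi_syntactic_semigroup (repr a * repr b)%g.

Lemma syntactic_mul_pi (u v : nonempty_word Sigma) :
  syntactic_mul (\pi_syntactic_semigroup u) (\pi_syntactic_semigroup v) =
  \pi_syntactic_semigroup (u * v)%g.
Proof.
apply/syntactic_piP => x y; rewrite !val_word_mul.
have /syntactic_piP hu := reprK (\pi_syntactic_semigroup u).
have /syntactic_piP hv := reprK (\pi_syntactic_semigroup v).
rewrite -!catA; apply: (iff_trans (hu x _)).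
have := hv (x ++ val u) y; rewrite -!catA; exact.
Qed.

Fact syntactic_mulA : associative syntactic_mul.
Proof.
elim/quotW=> u; elim/quotW=> v; elim/quotW=> w.
rewrite (syntactic_mul_pi v w) (syntactic_mul_pi u v).
by rewrite (syntactic_mul_pi u) (syntactic_mul_pi _ w) mulgA.
Qed.

HB.instance Definition _ :=
  isSemigroup.Build syntactic_semigroup syntactic_mulA.

End SyntacticSemigroup.

(* Main.v *)
Require Import Defs.
From HB Require Import structures.
From mathcomp Require Import all_boot.
From mathcomp Require Import boolp classical_sets.

Set Implicit Arguments.
Unset Strict Implicit.
Unset Printing Implicit Defensive.

(** Whether [w] is synchronizing depends only on the transformation induced by
    [w], so two words inducing the same transformation are syntactically
    congruent for [Syn B].  Sending the transformation induced by [u] to the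
    class of [u] is therefore well defined. *)

Local Open Scope quotient_scope.

Lemma word_action_congruence (Sigma : finType) (B : dfa Sigma) u v :
  word_action B u = word_action B v -> syntactic_congruence (Syn B) u v.
Proof.
move=> /ffunP uv x y.
(* Reading [x] leads to [run q x], where [u] and [v] act alike, so both runs agree before [y] is
   read. *)
have run_uv q : run q (x ++ u ++ y) = run q (x ++ v ++ y) :> B.
  by have := uv (run q x); rewrite !ffunE /run !foldl_cat => ->.
by split=> syn q q'; move: (syn q q'); rewrite !run_uv.
Qed.

Section TransitionToSyntactic.
Variables (Sigma : finType) (B : dfa Sigma).

(** Elements of the transition semigroup only assert that some word exists, so one is picked by
    choice. *)
Definition inducing_word (t : transition_semigroup B) : nonempty_word Sigma :=
  projT1 (cid (asboolW (valP t))).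

Lemma inducing_wordE t : word_action B (val (inducing_word t)) = val t.
Proof. by rewrite /inducing_word; case: cid. Qed.

Definition transition_to_syntactic (t : transition_semigroup B) :
  syntactic_semigroup (Syn B) := \pi_(syntactic_semigroup (Syn B)) (inducing_word t).

(** Independence of the choice: any word inducing [t] may replace the chosen one. *)
Lemma transition_to_syntacticE t (u : nonempty_word Sigma) :
  val t = word_action B (val u) -> transition_to_syntactic t = \pi_(syntactic_semigroup (Syn B)) u.
Proof.
move=> tu; apply/syntactic_piP/word_action_congruence.
by rewrite inducing_wordE.
Qed.

Fact transition_to_syntacticM :
  {morph transition_to_syntactic : s t / (s * t)%g}.
Proof.
(* The concatenation of the words chosen for [s] and [t] need not be the word chosen for [s * t]; it
   suffices that it induces [s * t]. *)
move=> s t; rewrite [RHS]syntactic_mul_pi; apply: transition_to_syntacticE.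
rewrite val_word_mul word_action_cat.
by apply/ffunP => q; rewrite !inducing_wordE !ffunE.
Qed.

HB.instance Definition _ :=
  isMultiplicative.Build (transition_semigroup B)
    (syntactic_semigroup (Syn B)) transition_to_syntactic
    transition_to_syntacticM.

Lemma transition_to_syntactic_surj (s : syntactic_semigroup (Syn B)) :
  exists t, transition_to_syntactic t = s.
Proof.
elim/quotW: s => u.
have act_u : `[< exists v : nonempty_word Sigma,
    word_action B (val u) = word_action B (val v) >].
  by apply/asboolP; exists u.
by exists (exist _ (word_action B (val u)) act_u); apply: transition_to_syntacticE.
Qed.

End TransitionToSyntactic.

Theorem proposition1 (Sigma : finType) (L : language Sigma) (B : dfa Sigma) :
  regular L -> ideal_language L -> synchronizing B -> Syn B = L ->
  exists f : {multiplicative transition_semigroup B -> syntactic_semigroup L},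
    forall s : syntactic_semigroup L, exists t : transition_semigroup B, f t = s.
Proof.
(* Substituting [Syn B] for [L] gives the codomain the type over which the map was built. *)
move=> _ _ _ <-; exists (@transition_to_syntactic Sigma B).
exact: transition_to_syntactic_surj.
Qed.
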